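(* Let $0<m<L<\infty$, let $\mathcal{G}=(\mathcal{V},\mathcal{E})$ be a directed graph with vertex set $\mathcal{V}=\{1,\dots,N_s\}$, and for each $r\in\{1,\dots,N_s\}$ let $\mathcal{A}_r\in\mathbb{R}^{n\times n}$, $\mathcal{B}_r\in\mathbb{R}^{n\times c}$, $\mathcal{C}_r\in\mathbb{R}^{c\times n}$. Suppose that there exist matrices $\Theta_r\in\mathbb{R}^{n\times c}$, $r=1,\dots,N_s$, such that $$\mathcal{A}_r\Theta_r-\Theta_{r'}=0\quad\text{for all }(r,r')\in\mathcal{E},\qquad \mathcal{C}_r\Theta_r=I_c\quad\text{for all } r\in\{1,\dots,N_s\},$$ and that the switched Lur'e interconnection $$v_{k+1}=\mathcal{A}_{s_k}v_k+\mathcal{B}_{s_k}\tilde w_k,\qquad \tilde z_k=\mathcal{C}_{s_k}v_k,\qquad \tilde w_k=\nabla f^0(\tilde z_k)\qquad(k\in\mathbb{N})$$ is asymptotically stable, i.e. $\lim_{k\to\infty}v_k=0$, for all $v_0\in\mathbb{R}^n$, all $f^0\in\mathcal{S}^0_{m,L}$ and all $s\in\mathrm{Path}(\mathcal{G})$. Then for every $f\in\mathcal{S}_{m,L}$ with minimizer $z^*$, every $s\in\mathrm{Path}(\mathcal{G})$ and every $x_0\in\mathbb{R}^n$, the algorithmic interconnection $$x_{k+1}=\mathcal{A}_{s_k}x_k+\mathcal{B}_{s_k}w_k,\qquad z_k=\mathcal{C}_{s_k}x_k,\qquad w_k=\nabla f(z_k)\qquad(k\in\mathbb{N})$$ converges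 to the optimal solution: $\lim_{k\to\infty}z_k=z^*$.
   Context: $\mathcal{S}_{m,L}$ is the set of functions $f:\mathbb{R}^c\to\mathbb{R}$ such that $f-\frac m2\|\cdot\|_2^2$ and $\frac L2\|\cdot\|_2^2-f$ are both convex (such $f$ are differentiable, and each has a unique minimizer, denoted $z^*$). $\mathcal{S}^0_{m,L}$ is the set of $f\in\mathcal{S}_{m,L}$ with $f(0)=0$ and $\nabla f(0)=0$. $\mathbb{N}$ includes $0$. $\mathrm{Path}(\mathcal{G})$ is the set of all infinite sequences $s=(s_k)_{k\in\mathbb{N}}$ in $\{1,\dots,N_s\}$ with $(s_k,s_{k+1})\in\mathcal{E}$ for all $k\in\mathbb{N}$. *)

(* Defs.v *)
From HB Require Import structures.
From mathcomp Require Import all_boot all_order all_algebra.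
From mathcomp Require Import all_classical all_reals all_analysis.

Set Implicit Arguments.
Unset Strict Implicit.
Unset Printing Implicit Defensive.

Import Order.TTheory GRing.Theory Num.Theory.
Import numFieldNormedType.Exports.

Local Open Scope classical_set_scope.
Local Open Scope ring_scope.

(* The library norm on ['cV[R]_c] is the sup norm, hence this definition. *)
Definition sqnorm2 (R : realType) (c : nat) (x : 'cV[R]_c) : R :=
  \sum_(i < c) x i 0 ^+ 2.

Definition S_mL (R : realType) (c : nat) (m L : R) : set ('cV[R]_c -> R) :=
  [set f | convex_function setT (fun x => f x - m / 2 * sqnorm2 x) /\
           convex_function setT (fun x => L / 2 * sqnorm2 x - f x)].

(* The vector of partial derivatives; it represents ['d f z] at every point of
   differentiability, hence everywhere when [f] is in [S_mL m L]. *)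
Definition gradient (R : realType) (c : nat) (f : 'cV[R]_c -> R)
    (z : 'cV[R]_c) : 'cV[R]_c :=
  \col_(i < c) 'D_(delta_mx i 0) f z.

Definition S0_mL (R : realType) (c : nat) (m L : R) : set ('cV[R]_c -> R) :=
  [set f | [/\ S_mL m L f, f 0 = 0 & gradient f 0 = 0]].

Definition minimizer (R : realType) (c : nat) (f : 'cV[R]_c -> R)
    (zstar : 'cV[R]_c) : Prop :=
  forall z, f zstar <= f z.

Definition Path (N : nat) (E : rel 'I_N) : set (nat -> 'I_N) :=
  [set s | forall k, E (s k) (s k.+1)].

(* The trajectory [(x, z, w)] started at [x0] is determined by the other
   arguments, since [z k] depends only on [x k] (there is no feedthrough). *)
Definition interconnection (R : realType) (N n c : nat)
    (A : 'I_N -> 'M[R]_n) (B : 'I_N -> 'M[R]_(n, c)) (C : 'I_N -> 'M[R]_(c, n))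
    (f : 'cV[R]_c -> R) (s : nat -> 'I_N) (x0 : 'cV[R]_n)
    (x : nat -> 'cV[R]_n) (z w : nat -> 'cV[R]_c) : Prop :=
  x 0%N = x0 /\
  forall k, [/\ x k.+1 = A (s k) *m x k + B (s k) *m w k,
                z k = C (s k) *m x k
              & w k = gradient f (z k)].

(* Main.v *)
(** The shifted function [f0 z := f (z + zstar) - f zstar] belongs to
    [S0_mL m L] and satisfies [gradient f0 z = gradient f (z + zstar)].  By the
    regulator equations, [v k := x k - Theta (s k) *m zstar] is a trajectory of
    the interconnection with [f0] whose output is [z k - zstar]; hence [v] tends
    to [0], and so does [z k - zstar = C (s k) *m v k] because the finitely many
    matrices [C r] are uniformly bounded. *)

Require Import Defs.
From HB Require Import structures.
From mathcomp Require Import all_boot all_order all_algebra.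
From mathcomp Require Import all_classical all_reals all_analysis.
From mathcomp Require Import ring lra.

Import Order.TTheory GRing.Theory Num.Theory.
Import numFieldNormedType.Exports.

Local Open Scope classical_set_scope.
Local Open Scope ring_scope.

Set Implicit Arguments.
Unset Strict Implicit.

Definition dot (R : realType) (c : nat) (x y : 'cV[R]_c) : R :=
  \sum_(i < c) x i 0 * y i 0.

Lemma dotDZl (R : realType) (c : nat) (t u : R) (x y a : 'cV[R]_c) :
  dot (t *: x + u *: y) a = t * dot x a + u * dot y a.
Proof.
rewrite /dot !mulr_sumr -big_split; apply: eq_bigr => i _ /=.
by rewrite !mxE; ring.
Qed.

Lemma sqnorm2D (R : realType) (c : nat) (x y : 'cV[R]_c) :
  sqnorm2 (x + y) = sqnorm2 x + 2 * dot x y + sqnorm2 y.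
Proof.
rewrite /sqnorm2 /dot mulr_sumr -!big_split; apply: eq_bigr => i _ /=.
by rewrite !mxE; ring.
Qed.

Lemma sqnorm2Z (R : realType) (c : nat) (t : R) (x : 'cV[R]_c) :
  sqnorm2 (t *: x) = t ^+ 2 * sqnorm2 x.
Proof.
by rewrite /sqnorm2 mulr_sumr; apply: eq_bigr => i _; rewrite !mxE exprMn.
Qed.

Lemma convex_functionP (R : realType) (c : nat) (g : 'cV[R]_c -> R) :
  convex_function setT g <->
  forall (t : {i01 R}) (x y : 'cV[R]_c),
    g (t%:num *: x + (1 - t%:num) *: y)
      <= t%:num * g x + (1 - t%:num) * g y.
Proof.
split=> [cg t x y|cg t x y _ _]; last exact: cg.
exact: (cg t x y (mem_set I) (mem_set I)).
Qed.

(** The affine term [dot x d + b] absorbs the cross term and the constant that appear when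
    [sqnorm2 (x + a)] is expanded. *)
Lemma convex_function_translate (R : realType) (c : nat)
    (g : 'cV[R]_c -> R) (a d : 'cV[R]_c) (b : R) :
  convex_function setT g ->
  convex_function setT (fun x : 'cV[R]_c => g (x + a) + dot x d + b).
Proof.
move=> /convex_functionP cg; apply/convex_functionP => t x y.
have -> : t%:num *: x + (1 - t%:num) *: y + a
    = t%:num *: (x + a) + (1 - t%:num) *: (y + a).
  by apply/colP => i; rewrite !mxE; ring.
have := cg t (x + a) (y + a); rewrite dotDZl; lra.
Qed.

Lemma S_mL_translate (R : realType) (c : nat) (m L : R) (f : 'cV[R]_c -> R)
    (a : 'cV[R]_c) (b : R) :
  S_mL m L f -> S_mL m L (fun x => f (x + a) + b).
Proof.
move=> [cm cL]; split.
- have := @convex_function_translate R c _ a (m *: a)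
    (b + m / 2 * sqnorm2 a) cm.
  congr convex_function; apply/funext => x.
  have -> : dot x (m *: a) = m * dot x a.
    by rewrite /dot mulr_sumr; apply: eq_bigr => i _; rewrite !mxE; ring.
  by rewrite sqnorm2D; field.
- have := @convex_function_translate R c _ a ((- L) *: a)
    (- b - L / 2 * sqnorm2 a) cL.
  congr convex_function; apply/funext => x.
  have -> : dot x ((- L) *: a) = - L * dot x a.
    by rewrite /dot mulr_sumr; apply: eq_bigr => i _; rewrite !mxE; ring.
  by rewrite sqnorm2D; field.
Qed.

(** The difference quotients of the two functions coincide before any limit is taken. *)
Lemma gradient_translate (R : realType) (c : nat) (f : 'cV[R]_c -> R)
    (a : 'cV[R]_c) (b : R) (z : 'cV[R]_c) :
  gradient (fun x => f (x + a) + b) z = gradient f (z + a).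
Proof.
apply/colP => i; rewrite !mxE /derive.
under eq_fun do rewrite /= opprD addrACA subrr addr0 -addrA.
by [].
Qed.

(* Midpoint convexity of [L / 2 * sqnorm2 - f] bounds the second difference of
   [f]; at a minimizer, one of its two halves can be dropped. *)
Lemma minimizer_quadratic_bound (R : realType) (c : nat) (m L : R)
    (f : 'cV[R]_c -> R) (a : 'cV[R]_c) :
  S_mL m L f -> minimizer f a ->
  forall v, f (v + a) - f a <= L * sqnorm2 v.
Proof.
move=> [_ /convex_functionP cL] fa v.
have half_ge0 : 0 <= 2^-1 :> R by lra.
have half_le1 : 2^-1 <= 1 :> R by lra.
(* The point [a - v] is written with [(- 1) *: v] so that [sqnorm2D] and [sqnorm2Z] apply to it. *)
have := cL (Itv01 half_ge0 half_le1) (a + v) (a + (- 1) *: v).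
rewrite [(Itv01 _ _)%:num]/=.
have -> : 2^-1 *: (a + v) + (1 - 2^-1) *: (a + (- 1) *: v) = a.
  by apply/colP => i; rewrite !mxE; field.
have := fa (a + (- 1) *: v).
rewrite !sqnorm2D !sqnorm2Z.
have -> : dot a ((- 1) *: v) = - dot a v.
  by rewrite /dot -sumrN; apply: eq_bigr => i _; rewrite !mxE; ring.
rewrite [v + a]addrC; lra.
Qed.

(** Minimality and the quadratic bound squeeze [f (h *: v + a) - f a] between [0] and
    [h ^+ 2 * (L * sqnorm2 v)]. Hence the difference quotients converge to [0], which gives
    existence and value of each partial derivative at once. *)
Lemma gradient_minimizer (R : realType) (c : nat) (m L : R)
    (f : 'cV[R]_c -> R) (a : 'cV[R]_c) :
  S_mL m L f -> minimizer f a -> gradient f a = 0.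
Proof.
move=> fS fa; apply/colP => i; rewrite !mxE /derive.
set v := delta_mx i 0; apply: cvg_lim => //.
apply/cvgr0Pnorm_le => e e0.
(* The absolute value covers either sign of [L]; the [+ 1] makes this divisor of [e] positive. *)
have K0 : 0 < `|L * sqnorm2 v| + 1 by rewrite ltr_wpDl.
near=> h.
have h0 : h != 0 by near: h; exact: nbhs_dnbhs_neq.
have hK : `|h| * (`|L * sqnorm2 v| + 1) <= e.
  rewrite -ler_pdivlMr //; near: h.
  by apply: dnbhs0_le; rewrite divr_gt0.
rewrite /= normrZ normfV ler_pdivrMl ?normr_gt0 //.
rewrite ger0_norm ?subr_ge0 ?fa //.
apply: (le_trans (minimizer_quadratic_bound fS fa _)).
(* One factor of [h ^+ 2] cancels the denominator of the quotient; the other is made small by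
   [hK]. *)
rewrite sqnorm2Z mulrCA -real_normK ?num_real // expr2 -mulrA.
rewrite ler_wpM2l //; apply: le_trans hK; rewrite ler_wpM2l //.
by rewrite (le_trans (ler_norm _)) // lerDl.
Unshelve. all: by end_near.
Qed.

(** For the sup norm the largest absolute row sum would do; the sum of all entries is a cruder
    constant. *)
Lemma normr_mulmx_le (R : realType) (p q : nat) (M : 'M[R]_(p, q))
    (v : 'cV[R]_q) :
  `|M *m v| <= (\sum_i \sum_j `|M i j|) * `|v|.
Proof.
have vj j : `|v j 0| <= `|v|.
  rewrite [leRHS]mx_normrE.
  exact: (le_bigmax _ (fun ij : 'I_q * 'I_1 => `|v ij.1 ij.2|) (j, 0)).
rewrite [leLHS]mx_normrE; apply: bigmax_le => /= [|[i j] _ /=].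
  by rewrite mulr_ge0 // sumr_ge0 // => i _; exact: sumr_ge0.
rewrite mxE (le_trans (ler_norm_sum _ _ _)) //.
apply: (@le_trans _ _ ((\sum_k `|M i k|) * `|v|)).
  rewrite mulr_suml; apply: ler_sum => k _.
  by rewrite normrM ler_wpM2l // (ord1 j).
by rewrite ler_wpM2r // (bigD1 i) //= lerDl sumr_ge0 // => k _; exact: sumr_ge0.
Qed.

(** The matrices [C (s k)] need not converge, so continuity of the product is replaced by a bound
    uniform in the mode: the sum of the constants [K r] dominates each of them. *)
Lemma cvg_switched_mulmx (R : realType) (N p q : nat) (C : 'I_N -> 'M[R]_(p, q))
    (s : nat -> 'I_N) (v : nat -> 'cV[R]_q) :
  v @ \oo --> (0 : 'cV[R]_q) ->
  (fun k => C (s k) *m v k) @ \oo --> (0 : 'cV[R]_p).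
Proof.
move=> v0; pose K r := \sum_i \sum_j `|C r i j|.
have K0 r : 0 <= K r by do 2![apply: sumr_ge0 => ? _].
have S0 : 0 < \sum_r K r + 1 by rewrite ltr_wpDl // sumr_ge0.
apply/cvgr0Pnorm_le => e e0.
near=> k.
rewrite (le_trans (normr_mulmx_le _ _)) //.
apply: (@le_trans _ _ ((\sum_r K r + 1) * `|v k|)).
  rewrite ler_wpM2r // (bigD1 (s k)) //= -addrA lerDl.
  by rewrite addr_ge0 // sumr_ge0.
rewrite mulrC -ler_pdivlMr //; near: k.
by move/cvgr0Pnorm_le: v0; apply; rewrite divr_gt0.
Unshelve. all: by end_near.
Qed.

Theorem theorem4p1 (R : realType) (Ns n c : nat) (m L : R)
    (m_gt0 : 0 < m) (m_lt_L : m < L) (E : rel 'I_Ns)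
    (A : 'I_Ns -> 'M[R]_n) (B : 'I_Ns -> 'M[R]_(n, c))
    (C : 'I_Ns -> 'M[R]_(c, n))
    (regulator : exists Theta : 'I_Ns -> 'M[R]_(n, c),
       (forall r r' : 'I_Ns, E r r' -> A r *m Theta r - Theta r' = 0) /\
       (forall r : 'I_Ns, C r *m Theta r = 1%:M))
    (stable : forall (v0 : 'cV[R]_n) (f0 : 'cV[R]_c -> R) (s : nat -> 'I_Ns),
       S0_mL m L f0 -> Path E s ->
       forall (v : nat -> 'cV[R]_n) (z w : nat -> 'cV[R]_c),
         interconnection A B C f0 s v0 v z w -> v @ \oo --> (0 : 'cV[R]_n)) :
  forall (f : 'cV[R]_c -> R) (zstar : 'cV[R]_c) (s : nat -> 'I_Ns)
      (x0 : 'cV[R]_n),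
    S_mL m L f -> minimizer f zstar -> Path E s ->
    forall (x : nat -> 'cV[R]_n) (z w : nat -> 'cV[R]_c),
      interconnection A B C f s x0 x z w -> z @ \oo --> zstar.
Proof.
move=> f zstar s x0 fS fmin sE x z w [_ dyn].
case: regulator => Theta [AT CT].
pose f0 y := f (y + zstar) + - f zstar.
pose v k := x k - Theta (s k) *m zstar.
have f0S : S0_mL m L f0.
  split; [exact: S_mL_translate | by rewrite /f0 add0r subrr |].
  by rewrite gradient_translate add0r; exact: gradient_minimizer fS fmin.
have zE k : z k - zstar = C (s k) *m v k.
  by have [_ -> _] := dyn k; rewrite mulmxBr mulmxA CT mul1mx.
(* Both loops share the input [w], so only the state and output offsets have to be matched. *)
have v_dyn : interconnection A B C f0 s (v 0%N) v (fun k => z k - zstar) w.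
  split=> // k; split=> //; last first.
    by have [_ _ ->] := dyn k; rewrite gradient_translate subrK.
  have [xS _ _] := dyn k.
  (* The offset of [v k.+1] uses the next mode [s k.+1]; the edge from [s k] to [s k.+1] identifies
     it with the image of the current offset under [A (s k)]. *)
  have /eqP := AT _ _ (sE k); rewrite subr_eq0 => /eqP ThS.
  by rewrite /v xS mulmxBr mulmxA ThS addrAC.
have v0 := stable _ _ _ f0S sE _ _ _ v_dyn.
apply/subr_cvg0; under eq_fun do rewrite zE.
exact: cvg_switched_mulmx.
Qed.
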